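(* Let $G_\bullet$ be a transitive $\mathrm{FI}$-graph. Then the family of simple random walks on the graphs $G_n$ does not exhibit cutoff.
   Context: $\mathrm{FI}$ denotes the category whose objects are the sets $[n]=\{1,\dots,n\}$ ($n\ge 0$) and whose morphisms are injective maps. An $\mathrm{FI}$-set is a functor $Z_\bullet$ from $\mathrm{FI}$ to finite sets; write $Z_n=Z_\bullet([n])$, which carries an induced action of the symmetric group $\mathfrak{S}_n$. $Z_\bullet$ is finitely generated in degree $\le d$ if for all $n\ge d$, $Z_{n+1}=\bigcup_f Z(f)(Z_n)$, the union over all injections $f:[n]\hookrightarrow[n+1]$. An $\mathrm{FI}$-graph $G_\bullet$ is a functor from $\mathrm{FI}$ to the category of finite graphs and graph homomorphisms; equivalently, a vertex $\mathrm{FI}$-set $V_\bullet$ together with a symmetric edge relation $E_\bullet$, i.e. a sub-$\mathrm{FI}$-set of $V_\bullet\times V_\bullet$ (a natural transformation $E_\bullet\to V_\bullet\times V_\bullet$ injective in each degree). All graphs are assumed connected. $G_\bullet$ is finitely generated if its vertex $\mathrm{FI}$-set is finitely generated (in some degree). $G_\bullet$ is transitive if it is finitely generated and for all $n\gg 0$ the action of $\mathfrak{S}_n$ on $V_n$ is transitive. The simple random walk on a graph moves from a vertex $y$ to each neighbor of $y$ with probability $1/\deg(y)$. For a family of irreducible aperiodic Markov chains $X^{(n)}_t$ with stationary distributions $\pi^{(n)}$, the mixing time $t_{\mathrm{mix}}^{(n)}(\epsilon)$ is the smallest $t$ such that for every starting state the total variation distance $\frac12\sum_x|P^t(x_0,x)-\pi^{(n)}(x)|$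 is at most $\epsilon$. The family mixes in eventually constant time if $t_{\mathrm{mix}}^{(n)}(\epsilon)=O(1)$ for every $\epsilon\in(0,1)$. The family exhibits cutoff if it does not mix in eventually constant time and for all $\epsilon\in(0,1)$, $\lim_{n\to\infty} t_{\mathrm{mix}}^{(n)}(\epsilon)/t_{\mathrm{mix}}^{(n)}(1-\epsilon)=1$. *)

(* Defs.v *)
From HB Require Import structures.
From mathcomp Require Import all_boot all_order all_algebra all_fingroup.
From mathcomp Require Import boolp classical_sets reals ereal topology normedtype sequences.
Set Implicit Arguments.
Unset Strict Implicit.
Unset Printing Implicit Defensive.
Import Order.TTheory GRing.Theory Num.Theory.
Import numFieldNormedType.Exports.

(* [n] is modelled by 'I_n.  Being a boolean subtype of a type of finite
   functions, equality of morphisms is extensional equality of the maps. *)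
Definition FIhom (m n : nat) := {f : {ffun 'I_m -> 'I_n} | injectiveb f}.

Lemma FIhom_id_subproof n : injectiveb [ffun i : 'I_n => i].
Proof. by apply/injectiveP => i j; rewrite !ffunE. Qed.

Definition FIid n : FIhom n n := Sub [ffun i : 'I_n => i] (FIhom_id_subproof n).

Lemma FIhom_comp_subproof m n p (g : FIhom n p) (f : FIhom m n) :
  injectiveb [ffun i => val g (val f i)].
Proof.
apply/injectiveP => i j; rewrite !ffunE.
by move/(injectiveP _ (valP g))/(injectiveP _ (valP f)).
Qed.

Definition FIcomp m n p (g : FIhom n p) (f : FIhom m n) : FIhom m p :=
  Sub [ffun i => val g (val f i)] (FIhom_comp_subproof g f).

Lemma FIhom_perm_subproof n (s : 'S_n) : injectiveb [ffun i => s i].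
Proof. by apply/injectiveP => i j; rewrite !ffunE => /perm_inj. Qed.

Definition FIperm n (s : 'S_n) : FIhom n n := Sub [ffun i => s i] (FIhom_perm_subproof s).

Record FIset := {
  FIobj :> nat -> finType;
  FImap : forall m n : nat, FIhom m n -> FIobj m -> FIobj n;
  FImap_id : forall n (x : FIobj n), FImap (FIid n) x = x;
  FImap_comp : forall m n p (g : FIhom n p) (f : FIhom m n) (x : FIobj m),
    FImap (FIcomp g f) x = FImap g (FImap f x)
}.

Definition FIact (Z : FIset) (n : nat) (x : Z n) (s : 'S_n) : Z n :=
  FImap (FIperm s) x.

Lemma FIact1 (Z : FIset) n : @FIact Z n ^~ 1%g =1 id.
Proof.
move=> x; rewrite /FIact -[RHS](FImap_id x); congr (FImap _ x).
by apply/val_inj/ffunP => i; rewrite /= !ffunE perm1.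
Qed.

(* The product of 'S_n is (s * t) i = t (s i), so the covariant functoriality
   of Z gives an action in the (right) sense of fingroup. *)
Lemma FIactM (Z : FIset) n (x : Z n) : act_morph (@FIact Z n) x.
Proof.
move=> s t; rewrite /FIact -FImap_comp; congr (FImap _ x).
by apply/val_inj/ffunP => i; rewrite /= !ffunE permM.
Qed.

Definition FIaction (Z : FIset) (n : nat) : {action 'S_n &-> Z n} :=
  TotalAction (@FIact1 Z n) (@FIactM Z n).

Definition FIset_transitive_at (Z : FIset) (n : nat) : bool :=
  [transitive [set: 'S_n], on [set: Z n] | FIaction Z n].

Definition FIset_generated_in_degree (Z : FIset) (d : nat) : Prop :=
  forall n, (d <= n)%N -> forall y : Z n.+1,
    exists (f : FIhom n n.+1) (x : Z n), y = FImap f x.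

Definition FIset_finitely_generated (Z : FIset) : Prop :=
  exists d, FIset_generated_in_degree Z d.

(* The edge relation is not required to be irreflexive: loops are allowed.
   The empty graph counts as connected (the complete graphs K_n form an
   FI-graph with K_0 empty); it cannot occur for large n when the symmetric
   groups act transitively in the sense of fingroup. *)
Record FIgraph := {
  FIvertex :> FIset;
  FIedge : forall n : nat, rel (FIvertex n);
  FIedge_sym : forall n : nat, symmetric (@FIedge n);
  FIedge_map : forall (m n : nat) (f : FIhom m n) (x y : FIvertex m),
    FIedge x y -> FIedge (FImap f x) (FImap f y);
  FIgraph_connected : forall (n : nat) (x y : FIvertex n),
    connect (@FIedge n) x y
}.

Definition FIgraph_finitely_generated (G : FIgraph) : Prop :=
  FIset_finitely_generated G.

Local Open Scope classical_set_scope.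
Local Open Scope ring_scope.

Definition FIgraph_transitive (G : FIgraph) : Prop :=
  FIgraph_finitely_generated G /\
  \forall n \near \oo, FIset_transitive_at G n.

Section MarkovChains.
Variable R : realType.

Fixpoint kernel_pow (T : finType) (P : T -> T -> R) (t : nat) (x y : T) : R :=
  if t is t'.+1 then \sum_(z : T) P x z * kernel_pow P t' z y
  else (x == y)%:R.

Definition stationary (T : finType) (P : T -> T -> R) (pi : T -> R) : Prop :=
  [/\ forall x, 0 <= pi x,
      \sum_(x : T) pi x = 1
    & forall y, \sum_(x : T) pi x * P x y = pi y].

Definition total_variation (T : finType) (mu nu : T -> R) : R :=
  2^-1 * \sum_(x : T) `|mu x - nu x|.

(* An infimum in the extended reals: it is the smallest admissible t when there
   is one and +oo otherwise; for stationary pi and eps > 0 the latter happens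
   only when P is periodic or reducible. *)
Definition mixing_time (T : finType) (P : T -> T -> R) (pi : T -> R)
    (eps : R) : \bar R :=
  ereal_inf [set (t%:R)%:E | t in
    [set t : nat | forall x, total_variation (kernel_pow P t x) pi <= eps]].

Definition mixes_in_eventually_constant_time (T : nat -> finType)
    (P : forall n, T n -> T n -> R) (pi : forall n, T n -> R) : Prop :=
  forall eps : R, 0 < eps < 1 ->
    exists C : R, \forall n \near \oo,
      (mixing_time (@P n) (@pi n) eps <= C%:E)%E.

(* In \bar R one has x / +oo = 0 and +oo / x = +oo for finite x >= 0, and
   +oo / +oo = 0, so the ratios do not tend to 1 when mixing times are infinite
   for arbitrarily large n.  Likewise x / 0 is +oo for x > 0 and 0 for x = 0. *)
Definition exhibits_cutoff (T : nat -> finType)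
    (P : forall n, T n -> T n -> R) (pi : forall n, T n -> R) : Prop :=
  ~ mixes_in_eventually_constant_time P pi /\
  forall eps : R, 0 < eps < 1 ->
    (fun n => (mixing_time (@P n) (@pi n) eps /
               mixing_time (@P n) (@pi n) (1 - eps))%E) @ \oo --> 1%E.

(* The degree of x is the number of its neighbours, x included if it carries a
   loop.  A vertex without neighbours (in a connected graph: the one-vertex
   graph without loop) is made absorbing, so that this is always a stochastic
   kernel. *)
Definition simple_random_walk (T : finType) (e : rel T) (x y : T) : R :=
  if #|e x| == 0%N then (x == y)%:R
  else if e x y then (#|e x|%:R)^-1 else 0.

End MarkovChains.

(* Main.v *)
Require Import Defs.
From HB Require Import structures.
From mathcomp Require Import all_boot all_order all_algebra all_fingroup.
From mathcomp Require Import boolp classical_sets reals ereal topology normedtype sequences.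
From mathcomp Require Import complex zify ring lra.
Set Implicit Arguments.
Unset Strict Implicit.
Unset Printing Implicit Defensive.
Import Order.TTheory GRing.Theory Num.Theory.
Import numFieldNormedType.Exports.

Local Open Scope classical_set_scope.
Local Open Scope ring_scope.

(* Let d_x(t) be the total variation distance between P^t(x, .) and pi. For some
   M independent of n, |d_x(t+2) - d_x(t)| <= M / (t+1), so d_x cannot fall from
   1 - eps to eps during o(t) steps around a time t tending to infinity.

   To get M, note that every pair of vertices of G_n is (f x, f' x') with x, x'
   in a fixed G_d, so the number N of S_n-orbits on pairs is bounded in n. By
   transitivity P is symmetric, and its powers are S_n-invariant; hence P^2 is
   killed by a polynomial of degree at most N with all its roots in [0, 1]. For
   each orbit O of pairs, u_s = P^(2s+r)(x, {y : (x, y) in O}) lies in [0, 1] and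
   is a combination of at most N exponentials with bases in [0, 1]. A
   discrete Bernstein inequality gives |u_(s+1) - u_s| <= C_N / (s+1), where C_N
   does not depend on the exponentials. *)

(** * Discrete Bernstein inequality for sums of exponentials *)

(* The product of the operators E - r for r in rs kills u, E being the shift. *)
Fixpoint annihilated (R : pzRingType) (rs : seq R) (u : nat -> R) : Prop :=
  if rs is r :: rs' then annihilated rs' (fun t => u t.+1 - r * u t)
  else forall t, u t = 0.

Lemma annihilated_ext (R : pzRingType) (rs : seq R) (u v : nat -> R) :
  u =1 v -> annihilated rs u -> annihilated rs v.
Proof.
elim: rs u v => [|r rs IH] u v uv /=; first by move=> u0 t; rewrite -uv.
by apply: IH => t; rewrite !uv.
Qed.

Lemma annihilated_shift (R : pzRingType) (rs : seq R) (u : nat -> R) m :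
  annihilated rs u -> annihilated rs (fun t => u (t + m)%N).
Proof.
by elim: rs u => [|r rs IH] u //= hu; exact: IH hu.
Qed.

Lemma annihilated_lin (R : comPzRingType) (rs : seq R) (a : R) (u v : nat -> R) :
  annihilated rs u -> annihilated rs v ->
  annihilated rs (fun t => u t + a * v t).
Proof.
elim: rs u v => [|r rs IH] u v /= hu hv.
  by move=> t; rewrite hu hv mulr0 addr0.
by apply: annihilated_ext (IH _ _ hu hv) => t /=; ring.
Qed.

(** [E - r] divides [E^m - r^m], by induction from [E^(m+1) - r^(m+1) = E^m (E - r) + r (E^m -
    r^m)]. *)
Lemma annihilated_stride (R : comPzRingType) (r : R) (rs : seq R)
    (u : nat -> R) m :
  annihilated (r :: rs) u ->
  annihilated rs (fun t => u (t + m)%N - r ^+ m * u t).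
Proof.
rewrite /= => hu; elim: m => [|m IH].
  have := annihilated_lin (-1) hu hu.
  by apply: annihilated_ext => t /=; rewrite addn0; ring.
apply: annihilated_ext (annihilated_lin r (annihilated_shift m hu) IH) => t /=.
by rewrite addnS exprS; ring.
Qed.

(** The recursion comes from the case [r ^+ m > 1/4] of [increment_bound]: [|w T| * S <= 2B + 2DB],
    where [S >= (m+1)/4 >= (T+1)/8]. *)
Fixpoint increment_const (N : nat) : nat :=
  if N is N'.+1 then (16 + 16 * increment_const N')%N else 0%N.

Lemma increment_const_leq m n :
  (m <= n)%N -> (increment_const m <= increment_const n)%N.
Proof.
elim: m n => [|m IH] [|n] //= mn.
by rewrite leq_add2l leq_mul2l /= IH.
Qed.

Lemma increment_bound (R : realFieldType) (rs : seq R) (u : nat -> R) (B : R) :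
  {in rs, forall r, 0 <= r <= 1} -> annihilated rs u ->
  (forall t, `|u t| <= B) ->
  forall t, `|u t.+1 - u t| * t.+1%:R <= (increment_const (size rs))%:R * B.
Proof.
(* E^m - r^m removes r from the list, so w (t + m) = r ^+ m * w t up to O(1/t) by
   induction. If r ^+ m is small for m about T/2, bound w T by w at T/2; otherwise
   w T, w (T + 1), ..., w (T + m) are comparable and have a bounded sum. *)
elim: rs u B => [|r rs IH] u B hrs hu uB.
  by move=> t /=; rewrite !hu subr0 normr0 !mul0r.
have /andP[r0 r1] : 0 <= r <= 1 by apply: hrs; rewrite mem_head.
have B0 : 0 <= B by apply: le_trans (uB 0%N).
set D : R := (increment_const (size rs))%:R.
have D0 : 0 <= D by rewrite ler0n.
pose w t := u t.+1 - u t.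
have stride m t : `|w (t + m)%N - r ^+ m * w t| * t.+1%:R <= D * (2 * B).
  have rm : 0 <= r ^+ m <= 1 by rewrite exprn_ge0 //= exprn_ile1.
  have := IH (fun t => u (t + m)%N - r ^+ m * u t) (2 * B) _
             (annihilated_stride m hu) _ t.
  rewrite (_ : _ - _ = w (t + m)%N - r ^+ m * w t); last by rewrite /w addSn; ring.
  apply.
    by move=> x xrs; apply: hrs; rewrite inE xrs orbT.
  move=> s; apply: le_trans (ler_normB _ _) _; rewrite normrM ger0_norm ?exprn_ge0 //.
  have h1 := uB (s + m)%N; have h2 := uB s; have h3 := normr_ge0 (u s).
  nra.
rewrite [increment_const _]/= natrD natrM -/D => T.
rewrite -/(w T).
elim/ltn_ind: T => T IHT.
set h := T./2; set m := (T - h)%N.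
have hT : (h <= T)%N by rewrite /h -{2}(odd_double_half T) -addnn; lia.
have hm : (h + m = T)%N by rewrite /m subnKC.
have h2 : (T.+1 <= 2 * h.+1)%N by have := odd_double_half T; rewrite -/h; case: odd; lia.
have m2 : (T.+1 <= 2 * m.+1)%N by have := odd_double_half T; rewrite -/h; case: odd; lia.
case: (lerP (r ^+ m) 4^-1) => rm; last first.
  have sum_w : \sum_(j < m.+1) w (T + j)%N = u (T + m.+1)%N - u T.
    rewrite -(big_mkord xpredT (fun j => w (T + j)%N)).
    by under eq_bigr => j _ do rewrite /w -addnS; rewrite telescope_sumr // addn0.
  have pow_ge : m.+1%:R * 4^-1 <= \sum_(j < m.+1) r ^+ j.
    rewrite mulr_natl -{1}(card_ord m.+1) -sumr_const; apply: ler_sum => j _.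
    by apply: le_trans (ltW rm) _; apply: ler_wiXn2l => //; rewrite -ltnS.
  have : `|\sum_(j < m.+1) (w (T + j)%N - r ^+ j * w T)| * T.+1%:R
         <= \sum_(j < m.+1) D * (2 * B).
    apply: le_trans (_ : (\sum_(j < m.+1) `|w (T + j)%N - r ^+ j * w T|) * T.+1%:R <= _).
      by rewrite ler_wpM2r // ler_norm_sum.
    by rewrite mulr_suml; apply: ler_sum => j _; apply: stride.
  rewrite sumrB sum_w -mulr_suml sumr_const card_ord -[X in _ <= X]mulr_natr => H.
  set S := \sum_(j < m.+1) _ in pow_ge H.
  have S_ge : T.+1%:R <= 8 * S.
    have : (T.+1%:R : R) <= 2 * m.+1%:R by rewrite -natrM ler_nat.
    lra.
  have S_wT : `|w T| * S <= 2 * B + `|u (T + m.+1)%N - u T - S * w T|.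
    have -> : `|w T| * S = `|S * w T|.
      by rewrite normrM mulrC ger0_norm //; have := ler0n R T.+1; lra.
    have := ler_normB (u (T + m.+1)%N - u T) (u (T + m.+1)%N - u T - S * w T).
    have := ler_normB (u (T + m.+1)%N) (u T); have := uB (T + m.+1)%N.
    by have := uB T; rewrite opprB addrCA subrr addr0; lra.
  have mT : (m.+1%:R : R) <= T.+1%:R by rewrite ler_nat ltnS leq_subr.
  have E_le : `|u (T + m.+1)%N - u T - S * w T| <= D * (2 * B).
    rewrite -(ler_pM2r (ltr0Sn R T)); apply: le_trans H _.
    by rewrite ler_wpM2l // !mulr_ge0.
  have := normr_ge0 (w T); nra.
(* If [h = T], then [m = 0] and [r ^+ m = 1], which exceeds [1/4]. *)
have hlt : (h < T)%N.
  rewrite ltnNge; apply/negP => Th; move: rm.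
  by rewrite /m (eqP (_ : T - h == 0)%N) ?subn_eq0 // expr0; lra.
have := IHT h hlt; have := stride m h; rewrite hm -/(w h).
have rm0 : 0 <= r ^+ m by rewrite exprn_ge0.
have T2 : (T.+1%:R : R) <= 2 * h.+1%:R by rewrite -natrM ler_nat.
have wT : `|w T| <= `|w T - r ^+ m * w h| + r ^+ m * `|w h|.
  by rewrite -{2}(ger0_norm rm0) -normrM -{1}(subrK (r ^+ m * w h) (w T)) ler_normD.
set a := `|w T - _| in wT *; set b := `|w h| in wT *.
have b0 : 0 <= b by exact: normr_ge0.
have h0 : 0 <= h.+1%:R :> R by [].
have wT0 := normr_ge0 (w T).
move=> ah bh.
(* Since [T+1 <= 2(h+1)], the threshold [1/4] leaves half of the inductive bound, [(8 + 8D)B]; with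
   the stride error [4DB] this stays below [(16 + 16D)B]. *)
have : r ^+ m * (b * h.+1%:R) <= 4^-1 * (b * h.+1%:R) by rewrite ler_wpM2r ?mulr_ge0.
nra.
Qed.

(** * Annihilating polynomials with roots in [0, 1] *)

(** Shifting [t] multiplies by [B], so each factor [B - r] acts on the sequence as [E - r]. The
    matrix [M] leaves room for an odd power of the kernel. *)
Lemma annihilated_horner (R : comNzRingType) m (B M : 'M[R]_m.+1) (rs : seq R)
    (L : 'M[R]_m.+1 -> R) :
  scalar L -> horner_mx B (\prod_(r <- rs) ('X - r%:P)) * M = 0 ->
  annihilated rs (fun t => L (B ^+ t * M)).
Proof.
move=> linL; elim: rs M => [|r rs IH] M /=.
  rewrite big_nil rmorph1 mul1r => -> t; rewrite mulr0.
  by have := linL (-1) 0 0; rewrite scaler0 addr0 mulN1r addNr.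
rewrite big_cons mulrC rmorphM -mulrA => /IH; apply: annihilated_ext => t.
rewrite /= [RHS]addrC -mulNr -linL; congr (L _).
rewrite rmorphB /= horner_mx_X horner_mx_C mulrBl mulrBr mulrA -exprSr addrC.
by rewrite scaleNr -[r%:M * M]/(r%:M *m M) mul_scalar_mx scalerAr.
Qed.

(** With absolute row sums at most 1, [v *m B] has l1 norm at most that of [v]; apply this to a left
    eigenvector. *)
Lemma eigenvalue_norm_le1 (C : numFieldType) m (B : 'M[C]_m) (a : C) :
  (forall i, \sum_j `|B i j| <= 1) -> eigenvalue B a -> `|a| <= 1.
Proof.
move=> B1 /eigenvalueP[v vB v0].
have /rV0Pn[j vj] := v0.
have S0 : 0 < \sum_j `|v 0 j|.
  rewrite (bigD1 j) //= ltr_pwDl ?normr_gt0 //.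
  by apply: sumr_ge0 => i _; apply: normr_ge0.
rewrite -(ler_pM2r S0) mul1r mulr_sumr.
apply: le_trans (_ : \sum_j \sum_i `|v 0 i| * `|B i j| <= _).
  apply: ler_sum => k _; rewrite -normrM.
  have <- : (v *m B) 0 k = a * v 0 k by rewrite vB mxE.
  rewrite mxE; apply: le_trans (ler_norm_sum _ _ _) _.
  by apply: ler_sum => i _; rewrite normrM.
rewrite exchange_big; apply: ler_sum => i _ /=.
by rewrite -mulr_sumr ler_piMr.
Qed.

(** A left eigenvector [v] satisfies [|v A|^2 = a |v|^2] in the Hermitian norm. *)
Lemma eigenvalue_gram_ge0 (C : numClosedFieldType) m n (A : 'M[C]_(m, n)) (a : C) :
  eigenvalue (A *m (map_mx Num.conj A)^T) a -> 0 <= a.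
Proof.
have gram p (w : 'rV[C]_p) :
    (w *m (map_mx Num.conj w)^T) 0 0 = \sum_j w 0 j * (w 0 j)^*.
  by rewrite mxE; apply: eq_bigr => j _; rewrite !mxE.
move=> /eigenvalueP[v vB v0].
have : (v *m A) *m (map_mx Num.conj (v *m A))^T
       = a *: (v *m (map_mx Num.conj v)^T).
  by rewrite map_mxM trmx_mul mulmxA -(mulmxA v A) vB scalemxAl.
move=> /matrixP/(_ 0 0); rewrite [RHS]mxE !gram => E.
have /rV0Pn[j vj] := v0.
have S0 : 0 < \sum_j v 0 j * (v 0 j)^*.
  rewrite (bigD1 j) //= ltr_pwDl ?mul_conjC_gt0 //.
  by apply: sumr_ge0 => i _; apply: mul_conjC_ge0.
rewrite -(pmulr_lge0 _ S0) -E.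
by apply: sumr_ge0 => i _; apply: mul_conjC_ge0.
Qed.

(* The r are the roots of the minimal polynomial of the positive semidefinite
   matrix A^2. *)
Lemma sqr_annihilator (R : rcfType) m (A : 'M[R]_m.+1) (p : {poly R}) :
  A^T = A -> (forall i, \sum_j `|A i j| <= 1) -> p != 0 ->
  horner_mx (A ^+ 2) p = 0 ->
  exists rs : seq R,
    [/\ (size rs < size p)%N, {in rs, forall r, 0 <= r <= 1}
      & horner_mx (A ^+ 2) (\prod_(r <- rs) ('X - r%:P)) = 0].
Proof.
move=> symA A1 p0 pA.
(* The minimal polynomial splits over [R[i]]; its roots turn out to be real, so the factorization
   descends to [R]. *)
pose f : {rmorphism R -> R[i]} := real_complex R.
set B := A ^+ 2.
pose q := mxminpoly (map_mx f B).
have [zs Dq] := closed_field_poly_normal q.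
rewrite (monicP (mxminpoly_monic _)) scale1r in Dq.
have zs01 : {in zs, forall z, 0 <= z <= 1}.
  move=> z zzs.
  have eigz : eigenvalue (map_mx f B) z.
    by rewrite eigenvalue_root_min -/q Dq root_prod_XsubC.
  have z0 : 0 <= z.
    (* As [A] is real and symmetric, [A^2] is the Gram matrix of [A]. *)
    apply: (@eigenvalue_gram_ge0 _ _ _ (map_mx f A)).
    congr (eigenvalue _ z): eigz; rewrite /B expr2 -mulmxE map_mxM; congr (_ *m _).
    rewrite -[in LHS]symA; apply/matrixP => i j; rewrite !mxE.
    by rewrite conj_Creal //; apply/complex_realP; exists (A j i).
  rewrite z0 /= -(ger0_norm z0); apply: eigenvalue_norm_le1 eigz => i.
  have normf x : `|f x| = f `|x|.
    by rewrite normc_def /= expr0n addr0 sqrtr_sqr.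
  under eq_bigr => j _ do rewrite mxE normf.
  rewrite -rmorph_sum lecR.
  apply: le_trans (_ : \sum_j \sum_k `|A i k| * `|A k j| <= _).
    apply: ler_sum => j _; rewrite /B expr2 -mulmxE mxE.
    apply: le_trans (ler_norm_sum _ _ _) _.
    by apply: ler_sum => k _; rewrite normrM.
  rewrite exchange_big; apply: le_trans (A1 i); apply: ler_sum => k _ /=.
  by rewrite -mulr_sumr ler_piMr.
have zs_re z : z \in zs -> f (complex.Re z) = z.
  by move=> /zs01/andP[z0 _]; apply: RRe_real; rewrite ger0_real.
have map_rs : map f [seq complex.Re z | z <- zs] = zs.
  by rewrite -map_comp; apply: map_id_in => z /zs_re.
exists [seq complex.Re z | z <- zs]; split.
- rewrite size_map -(size_prod_XsubC zs id) -Dq -(size_map_poly f p).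
  apply: dvdp_leq; first by rewrite map_poly_eq0.
  by apply: mxminpoly_min; rewrite -map_horner_mx pA map_mx0.
- move=> r /mapP[z zzs ->].
  by have := zs01 z zzs; rewrite -(zs_re z zzs) ler0c lecR.
- apply: (map_mx_inj (f := f)).
  rewrite map_horner_mx rmorph_prod map_mx0 big_map.
  rewrite -[RHS](mx_root_minpoly (map_mx f B)) -/q Dq; congr (horner_mx _ _).
  apply: eq_big_seq => z zzs.
  by rewrite rmorphB /= map_polyX map_polyC /= zs_re.
Qed.

(** * Total variation for kernels determined by a coloring of pairs *)

Lemma kernel_pow_ge0 (R : realType) (T : finType) (P : T -> T -> R) t x y :
  (forall x y, 0 <= P x y) -> 0 <= kernel_pow P t x y.
Proof.
move=> P0; elim: t x y => [|t IH] x y /=; first by rewrite ler0n.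
by apply: sumr_ge0 => z _; rewrite mulr_ge0.
Qed.

Lemma kernel_pow_sum1 (R : realType) (T : finType) (P : T -> T -> R) t x :
  (forall x, \sum_y P x y = 1) -> \sum_y kernel_pow P t x y = 1.
Proof.
move=> P1; elim: t x => [|t IH] x /=.
  rewrite (bigD1 x) //= eqxx big1 ?addr0 // => y yx.
  by rewrite eq_sym (negbTE yx).
rewrite exchange_big -[RHS](P1 x); apply: eq_bigr => z _ /=.
by rewrite -mulr_sumr IH mulr1.
Qed.

Lemma kernel_pow_mx (R : realType) (T : finType) (P : T -> T -> R) m
    (f : 'I_m.+1 -> T) t i j :
  bijective f ->
  kernel_pow P t (f i) (f j) = ((\matrix_(i, j) P (f i) (f j)) ^+ t) i j.
Proof.
move=> bij_f; elim: t i => [|t IH] i.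
  by rewrite expr0 mxE /= (inj_eq (bij_inj bij_f)).
rewrite exprS -mulmxE mxE /= (reindex f) /=; last exact: onW_bij.
by apply: eq_bigr => k _; rewrite IH mxE.
Qed.

(* The even powers of the kernel lie in a space of dimension #|K|. *)
Lemma colored_annihilator (R : realType) (T K : finType) (P : T -> T -> R)
    (c : T -> T -> K) m (f : 'I_m.+1 -> T) :
  bijective f ->
  (forall t x y x' y', c x y = c x' y' ->
     kernel_pow P t x y = kernel_pow P t x' y') ->
  exists p : {poly R}, [/\ p != 0, (size p <= #|K|.+1)%N
    & horner_mx ((\matrix_(i, j) P (f i) (f j)) ^+ 2) p = 0].
Proof.
move=> bij_f Pc; set A := \matrix_(i, j) _.
pose W : 'M[R]_(#|K|.+1, #|K|) := \matrix_(i, k)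
  if [pick z | c z.1 z.2 == enum_val k] is Some z
  then kernel_pow P (2 * i) z.1 z.2 else 0.
have /rowV0Pn[v /sub_kermxP vW v0] : kermx W != 0.
  rewrite kermx_eq0; apply/negP => /eqP rkW.
  by have := rank_leq_col W; rewrite rkW ltnn.
exists (rVpoly v); split.
- by apply: contra v0 => /eqP v0; rewrite -(rVpolyK v) v0 linear0.
- exact: size_poly.
rewrite horner_rVpoly mulmx_sum_row linear_sum; apply/matrixP => i j.
have := congr1 (fun M : 'rV_ _ => M 0 (enum_rank (c (f i) (f j)))) vW.
rewrite mxE [RHS]mxE => E; rewrite [RHS]mxE -{}[RHS]E summxE.
apply: eq_bigr => l _; rewrite linearZ /= rowK mxvecK !mxE enum_rankK.
rewrite -exprM -kernel_pow_mx //; congr (_ * _).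
case: pickP => [z /eqP cz|/(_ (f i, f j))]; last by rewrite eqxx.
by apply: Pc; rewrite cz.
Qed.

Lemma total_variation_lipschitz (R : realType) (T : finType) (mu1 mu2 nu : T -> R) :
  `|total_variation mu1 nu - total_variation mu2 nu|
    <= 2^-1 * \sum_y `|mu1 y - mu2 y|.
Proof.
rewrite /total_variation -mulrBr normrM ger0_norm ?invr_ge0 // ler_wpM2l ?invr_ge0 //.
rewrite -sumrB; apply: le_trans (ler_norm_sum _ _ _) _; apply: ler_sum => y _.
have -> : mu1 y - mu2 y = (mu1 y - nu y) - (mu2 y - nu y) by ring.
exact: ler_dist_dist.
Qed.

Lemma colored_tv_increment (R : realType) (T K : finType) (P : T -> T -> R)
    (c : T -> T -> K) :
  (forall x y, P x y = P y x) -> (forall x y, 0 <= P x y) ->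
  (forall x, \sum_y P x y = 1) ->
  (forall t x y x' y', c x y = c x' y' ->
     kernel_pow P t x y = kernel_pow P t x' y') ->
  forall x (mu : T -> R) t,
    `|total_variation (kernel_pow P t.+2 x) mu
      - total_variation (kernel_pow P t x) mu| * t.+1%:R
    <= (#|K| * increment_const #|K|)%:R.
Proof.
move=> symP P0 P1 Pc x mu t.
have [m cardT] : exists m, #|T| = m.+1.
  by case: #|T| (fintype0 (T := T) x) => [|m]; [move/(_ erefl)|exists m].
pose f : 'I_m.+1 -> T := fun i => enum_val (cast_ord (esym cardT) i).
have bij_f : bijective f.
  exists (fun y => cast_ord cardT (enum_rank y)) => y; rewrite /f.
    by rewrite enum_valK cast_ordKV.
  by rewrite cast_ordK enum_rankK.
have [p [p0 sp pB]] := colored_annihilator bij_f Pc.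
set A := \matrix_(i, j) _ in pB.
have symA : A^T = A by apply/matrixP => i j; rewrite !mxE.
have A1 i : \sum_j `|A i j| <= 1.
  rewrite -(P1 (f i)) [leRHS](reindex f) /=; last exact: onW_bij.
  by apply: ler_sum => j _; rewrite mxE ger0_norm.
have [rs [srs rs01 rsB]] := sqr_annihilator symA A1 p0 pB.
pose U k s := \sum_(y | c x y == k) kernel_pow P s x y.
have U_le1 k s : `|U k s| <= 1.
  rewrite ger0_norm; last by apply: sumr_ge0 => y _; apply: kernel_pow_ge0.
  rewrite -(kernel_pow_sum1 s x P1) [leRHS](bigID (fun y => c x y == k)) /=.
  by rewrite lerDl; apply: sumr_ge0 => y _; apply: kernel_pow_ge0.
have U_increment k r s :
    `|U k (s.*2 + r).+2 - U k (s.*2 + r)%N| * s.+1%:R <= (increment_const #|K|)%:R.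
  have [i0 fi0] : exists i, f i = x by case: bij_f => g _ gK; exists (g x).
  pose L (M : 'M[R]_m.+1) := \sum_(j | c x (f j) == k) M i0 j.
  have linL : scalar L.
    move=> a M N; rewrite /L mulr_sumr -big_split.
    by apply: eq_bigr => j _; rewrite !mxE.
  have UL s' : U k (s'.*2 + r)%N = L ((A ^+ 2) ^+ s' * A ^+ r).
    rewrite /U (reindex f) /=; last exact: onW_bij.
    apply: eq_bigr => j _; rewrite -exprM mul2n -exprD -fi0.
    exact: kernel_pow_mx.
  have ann : annihilated rs (fun s => U k (s.*2 + r)%N).
    apply: (annihilated_ext (fun s' => esym (UL s'))).
    by apply: annihilated_horner => //; rewrite rsB mul0r.
  have := increment_bound rs01 ann (fun s => U_le1 k _) s.
  rewrite doubleS mulr1 => H; apply: le_trans H _.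
  by rewrite ler_nat increment_const_leq // -ltnS (leq_trans srs).
have tv_le : `|total_variation (kernel_pow P t.+2 x) mu
      - total_variation (kernel_pow P t x) mu| <=
    2^-1 * \sum_k `|U k t.+2 - U k t|.
  pose D y := kernel_pow P t.+2 x y - kernel_pow P t x y.
  have Dc y y' : c x y = c x y' -> D y = D y'.
    by move=> cy; congr (_ - _); apply: Pc.
  have UD k : U k t.+2 - U k t = \sum_(y | c x y == k) D y by rewrite /U -sumrB.
  apply: le_trans (total_variation_lipschitz _ _ _ : _ <= 2^-1 * \sum_y `|D y|) _.
  rewrite ler_wpM2l ?invr_ge0 //.
  rewrite (partition_big (c x) predT) //; apply: ler_sum => k _; rewrite UD.
  clearbody D => /=.
  have [y0 /eqP cy0|no] := pickP (fun y => c x y == k); last by rewrite !big_pred0 ?normr0.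
  have Dk y : c x y == k -> D y = D y0 by move=> /eqP cy; apply: Dc; rewrite cy.
  rewrite (eq_bigr (fun=> `|D y0|)) => [|y /Dk -> //].
  by rewrite (eq_bigr _ Dk) !sumr_const normrMn.
have tE : t = (t./2.*2 + odd t)%N by rewrite addnC odd_double_half.
apply: le_trans (ler_wpM2r (ler0n _ _) tv_le) _.
apply: le_trans (_ : \sum_k `|U k t.+2 - U k t| * (t./2).+1%:R <= _).
  rewrite -mulr_suml mulrAC mulrC ler_wpM2l ?sumr_ge0 //.
  rewrite ler_pdivrMl // -natrM ler_nat {1}tE; case: odd; lia.
rewrite natrM mulr_natl -sumr_const; apply: ler_sum => k _.
by rewrite {1 2}tE U_increment.
Qed.

Lemma perm_extension (I T : finType) (F F' : I -> T) :
  (forall a b, F a = F b <-> F' a = F' b) ->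
  exists s : {perm T}, forall a, s (F a) = F' a.
Proof.
move=> FF'.
suff [s sF] : exists s : {perm T}, forall a, a \in enum I -> s (F a) = F' a.
  by exists s => a; apply: sF; rewrite mem_enum.
elim: (enum I) => [|a l [s sF]]; first by exists 1%g.
have [/hasP[b bl /eqP Fab]|no] := boolP (has (fun b => F a == F b) l).
  exists s => a'; rewrite inE => /predU1P[->|]; last exact: sF.
  by rewrite Fab sF //; apply/esym/FF'.
have Fa b : b \in l -> F a <> F b.
  by move=> bl Fab; case/hasP: no; exists b => //; apply/eqP.
exists (s * tperm (s (F a)) (F' a))%g => b.
rewrite inE permM => /predU1P[->|bl]; first by rewrite tpermL.
rewrite (sF _ bl) tpermD //; apply/eqP.
  by rewrite -(sF _ bl) => /perm_inj H; apply: Fa bl H.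
by move=> /FF' H; apply: Fa bl H.
Qed.

Lemma FIset_generated_above (Z : FIset) d n (y : Z n) :
  FIset_generated_in_degree Z d -> (d <= n)%N ->
  exists (f : FIhom d n) (x : Z d), y = FImap f x.
Proof.
move=> genZ; elim: n y => [|n IH] y.
  by rewrite leqn0 => /eqP d0; subst d; exists (FIid 0), y; rewrite FImap_id.
rewrite leq_eqVlt => /predU1P[d0|].
  by subst d; exists (FIid n.+1), y; rewrite FImap_id.
rewrite ltnS => dn; have [g [z ->]] := genZ n dn y.
have [f [x ->]] := IH z dn.
by exists (FIcomp g f), x; rewrite FImap_comp.
Qed.

(* A pair (f x, f' x') of vertices is determined up to a permutation by x, x'
   and the pairs (i, j) with f i = f' j. *)
Lemma FIset_pair_coloring (Z : FIset) d n :
  FIset_generated_in_degree Z d -> (d <= n)%N ->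
  exists c : Z n -> Z n -> Z d * Z d * {set 'I_d * 'I_d},
    forall x y x' y', c x y = c x' y' ->
      exists s : 'S_n, FIact x s = x' /\ FIact y s = y'.
Proof.
move=> genZ dn.
have ex_g (y : Z n) : exists z : FIhom d n * Z d, y = FImap z.1 z.2.
  by have [f [x ->]] := FIset_generated_above y genZ dn; exists (f, x).
have [g gE] := choice ex_g.
exists (fun x y => ((g x).2, (g y).2,
  [set z : 'I_d * 'I_d | val (g x).1 z.1 == val (g y).1 z.2]%SET)).
move=> x y x' y' [x2 y2 /setP xy].
pose F u v (a : 'I_d + 'I_d) : 'I_n :=
  match a with inl i => val (g u).1 i | inr j => val (g v).1 j end.
have inj u : injective (val (g u).1) by apply/injectiveP/(valP (g u).1).
have [s sF] : exists s : 'S_n, forall a, s (F x y a) = F x' y' a.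
  apply: perm_extension => -[i|i] [j|j] /=.
  - by split=> /inj ->.
  - have := xy (i, j); rewrite !inE /= => E.
    by split=> /eqP; [rewrite E|rewrite -E] => /eqP.
  - have := xy (j, i); rewrite !inE /= => E.
    by split=> /esym/eqP; [rewrite E|rewrite -E] => /eqP.
  - by split=> /inj ->.
exists s; rewrite /FIact; split.
  rewrite (gE x) (gE x') -FImap_comp x2; congr (FImap _ _).
  by apply/val_inj/ffunP => i; rewrite /= !ffunE; apply: (sF (inl i)).
rewrite (gE y) (gE y') -FImap_comp y2; congr (FImap _ _).
by apply/val_inj/ffunP => i; rewrite /= !ffunE; apply: (sF (inr i)).
Qed.

Lemma FIedge_act (G : FIgraph) n (x y : G n) (s : 'S_n) :
  FIedge (FIact x s) (FIact y s) = FIedge x y.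
Proof.
apply/idP/idP; last exact: FIedge_map.
move=> /(FIedge_map (FIperm s^-1)).
rewrite -[FImap _ (FIact x s)]/(FIaction G n (FIaction G n x s) s^-1%g).
by rewrite -[FImap _ (FIact y s)]/(FIaction G n (FIaction G n y s) s^-1%g) !actK.
Qed.

Lemma degree_inj (T : finType) (e : rel T) (s : T -> T) x :
  injective s -> (forall x y, e (s x) (s y) = e x y) -> #|e (s x)| = #|e x|.
Proof.
move=> inj_s se; rewrite -(fintype.card_image inj_s (e x)); apply: eq_card => y.
rewrite -(f_invF inj_s y) fintype.mem_image //.
exact: se.
Qed.

Lemma kernel_pow_inj (R : realType) (T : finType) (P : T -> T -> R) (s : T -> T) t x y :
  injective s -> (forall x y, P (s x) (s y) = P x y) ->
  kernel_pow P t (s x) (s y) = kernel_pow P t x y.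
Proof.
move=> inj_s sP; elim: t x => [|t IH] x /=; first by rewrite (inj_eq inj_s).
by rewrite (reindex_inj inj_s); apply: eq_bigr => z _; rewrite sP IH.
Qed.

Lemma simple_random_walk_ge0 (R : realType) (T : finType) (e : rel T) x y :
  0 <= simple_random_walk R e x y.
Proof.
by rewrite /simple_random_walk; case: ifP => _; [|case: ifP => _];
  rewrite ?ler0n ?invr_ge0 ?ler0n.
Qed.

Lemma simple_random_walk_sum1 (R : realType) (T : finType) (e : rel T) x :
  \sum_y simple_random_walk R e x y = 1.
Proof.
rewrite /simple_random_walk; have [_|d0] := eqVneq #|e x| 0%N.
  rewrite (bigD1 x) //= eqxx big1 ?addr0 // => y yx.
  by rewrite eq_sym (negbTE yx).
rewrite -big_mkcond sumr_const -[LHS]mulr_natl mulfV // pnatr_eq0.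
exact: d0.
Qed.

Lemma simple_random_walk_inj (R : realType) (T : finType) (e : rel T) (s : T -> T) x y :
  injective s -> (forall x y, e (s x) (s y) = e x y) ->
  simple_random_walk R e (s x) (s y) = simple_random_walk R e x y.
Proof.
move=> inj_s se.
by rewrite /simple_random_walk (degree_inj x inj_s se) se (inj_eq inj_s).
Qed.

Lemma simple_random_walk_sym (R : realType) (T : finType) (e : rel T) x y :
  symmetric e -> #|e x| = #|e y| ->
  simple_random_walk R e x y = simple_random_walk R e y x.
Proof. by move=> sym_e exy; rewrite /simple_random_walk exy (sym_e x) (eq_sym x). Qed.

Lemma FIgraph_tv_increment (R : realType) (G : FIgraph) :
  FIgraph_transitive G -> exists M : R, \forall n \near \oo,
    forall (mu : G n -> R) x t,
      let tv s := total_variation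
                    (kernel_pow (simple_random_walk R (@FIedge G n)) s x) mu in
      `|tv t.+2 - tv t| * t.+1%:R <= M.
Proof.
move=> [[d genG] transG].
pose N := #|{: G d * G d * {set 'I_d * 'I_d}}|.
exists (N * increment_const N)%:R; near=> n => mu x t /=.
have dn : (d <= n)%N by near: n; exact: nbhs_infty_ge.
have tr : FIset_transitive_at G n by near: n.
have inj_act (s : 'S_n) : injective (fun x : G n => FIact x s).
  exact: (act_inj (FIaction G n) s).
have [c cP] := FIset_pair_coloring genG dn.
apply: colored_tv_increment (c) _ _ _ _ _ _ _.
- move=> y z; apply: simple_random_walk_sym; first exact: FIedge_sym.
  have [s _ ->] := atransP2 tr (finset.in_setT y) (finset.in_setT z).
  by rewrite -[FIaction G n y s]/(FIact y s) (degree_inj y (inj_act s)) // => *; apply: FIedge_act.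
- exact: simple_random_walk_ge0.
- exact: simple_random_walk_sum1.
move=> s y z y' z' /cP[a [<- <-]]; apply/esym.
apply: (kernel_pow_inj _ _ _ (inj_act a)) => u v.
by apply: (simple_random_walk_inj _ _ _ (inj_act a)) => *; apply: FIedge_act.
Unshelve. all: by end_near.
Qed.

Variant mixing_time_spec (R : realType) (T : finType) (P : T -> T -> R)
    (pi : T -> R) (eps : R) : \bar R -> Prop :=
| MixingTimeInfinite : mixing_time_spec P pi eps +oo%E
| MixingTimeFinite t of
    (forall x, total_variation (kernel_pow P t x) pi <= eps) &
    (forall s, (forall x, total_variation (kernel_pow P s x) pi <= eps) ->
       (t <= s)%N) :
  mixing_time_spec P pi eps (t%:R)%:E.

Lemma mixing_timeP (R : realType) (T : finType) (P : T -> T -> R) (pi : T -> R) eps :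
  mixing_time_spec P pi eps (mixing_time P pi eps).
Proof.
rewrite /mixing_time; set S := [set t : nat | _].
have [[t0 St0]|noS] := pselect (exists t, S t); last first.
  rewrite (_ : S = set0) ?image_set0 ?ereal_inf0; first exact: MixingTimeInfinite.
  by apply/seteqP; split=> // t St; apply: noS; exists t.
have exS : exists t, `[< S t >] by exists t0; apply/asboolP.
case: (ex_minnP exS) => t /asboolP St tmin.
rewrite (_ : ereal_inf _ = (t%:R)%:E).
  by apply: MixingTimeFinite St _ => s Ss; apply/tmin/asboolP.
apply/eqP; rewrite eq_le; apply/andP; split.
  by apply: ereal_inf_lbound; exists t.
apply: le_ereal_inf_tmp => _ [s Ss <-].
by rewrite lee_fin ler_nat; apply/tmin/asboolP.
Qed.

Lemma le_mixing_time (R : realType) (T : finType) (P : T -> T -> R) (pi : T -> R) e e' :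
  e <= e' -> (mixing_time P pi e' <= mixing_time P pi e)%E.
Proof.
move=> ee'; case: (mixing_timeP P pi e) => [|t tP _]; first exact: leey.
by apply: ereal_inf_lbound; exists t => // x; apply: le_trans (tP x) ee'.
Qed.

Lemma harmonic_telescope (R : realType) (u : nat -> R) M s j :
  (forall t, `|u t.+2 - u t| * t.+1%:R <= M) ->
  (u s - u (s + j.*2)%N) * s.+1%:R <= j%:R * M.
Proof.
move=> uM; elim: j => [|j IH]; first by rewrite addn0 subrr !mul0r.
rewrite doubleS !addnS -natr1.
set t := (s + j.*2)%N in IH *.
have : `|u t.+2 - u t| * s.+1%:R <= M.
  apply: le_trans (uM t); rewrite ler_wpM2l // ler_nat ltnS /t leq_addr //.
have : (u t - u t.+2) * s.+1%:R <= `|u t.+2 - u t| * s.+1%:R.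
  by rewrite ler_wpM2r // distrC ler_norm.
lra.
Qed.

Lemma no_cutoff (R : realType) (T : nat -> finType)
    (P : forall n, T n -> T n -> R) (pi : forall n, T n -> R) (M : R) :
  (\forall n \near \oo, forall x t,
     let tv s := total_variation (kernel_pow (@P n) s x) (@pi n) in
     `|tv t.+2 - tv t| * t.+1%:R <= M) ->
  ~ exhibits_cutoff P pi.
Proof.
move=> tvM [slow cutoff]; apply: slow => eps0 /andP[eps00 eps01].
pose eps : R := Num.min eps0 4^-1.
have [eps_eps0 eps4] : eps <= eps0 /\ eps <= 4^-1 by rewrite /eps !ge_min !lexx orbT.
have eps_gt0 : 0 < eps by rewrite lt_min eps00 invr_gt0 ltr0n.
pose M' : R := `|M|.
have M0 : 0 <= M' by exact: normr_ge0.
pose del : R := (4 * (M' + 1))^-1.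
have del0 : 0 < del by rewrite invr_gt0 mulr_gt0 //; lra.
have Mdel : M' * del <= 4^-1.
  by rewrite /del invfM mulrCA ger_pMr ?invr_gt0 // ler_pdivrMr; lra.
exists ((1 + del) * (8 * (M' + 1))).
have ratio_lt : \forall n \near \oo,
    (mixing_time (@P n) (@pi n) eps / mixing_time (@P n) (@pi n) (1 - eps)
       < (1 + del)%:E)%E.
  have /cutoff/(_ [set r | (r < (1 + del)%:E)%E]) : 0 < eps < 1 by rewrite eps_gt0; lra.
  by apply; apply: (nbhs_open_ereal_lt (f := fun=> 1 + del)); rewrite ltrDl.
have ratio_gt : \forall n \near \oo,
    (0%:E < mixing_time (@P n) (@pi n) eps / mixing_time (@P n) (@pi n) (1 - eps))%E.
  have /cutoff/(_ [set r | (0%:E < r)%E]) : 0 < eps < 1 by rewrite eps_gt0; lra.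
  by apply; apply: (nbhs_open_ereal_gt (f := fun=> 0)); rewrite ltr01.
near=> n.
have tvn : forall x t,
    let tv s := total_variation (kernel_pow (@P n) s x) (@pi n) in
    `|tv t.+2 - tv t| * t.+1%:R <= M by near: n.
have : (mixing_time (@P n) (@pi n) eps / mixing_time (@P n) (@pi n) (1 - eps)
       < (1 + del)%:E)%E by near: n.
have : (0%:E < mixing_time (@P n) (@pi n) eps / mixing_time (@P n) (@pi n) (1 - eps))%E.
  by near: n.
move=> ratio0 ratio1; apply: le_trans (le_mixing_time _ _ eps_eps0) _.
move: ratio0 ratio1.
case: (mixing_timeP (@P n) (@pi n) (1 - eps)) => [|t2 t2P t2min].
  by rewrite invey mule0 ltxx.
case: t2 t2P t2min => [|t2] t2P t2min.
  rewrite inver eqxx; case: (mixing_timeP (@P n) (@pi n) eps) => [|t1 _ _].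
    by rewrite mulyy.
  case: t1 => [|t1]; first by rewrite mul0e ltxx.
  by rewrite gt0_muley // lte_fin ltr0n.
rewrite inver pnatr_eq0 /=.
case: (mixing_timeP (@P n) (@pi n) eps) => [|t1 t1P t1min].
  by rewrite gt0_mulye // lte_fin invr_gt0 ltr0n.
move=> _; rewrite -EFinM lte_fin ltr_pdivrMr ?ltr0n // => t12.
rewrite lee_fin leNgt; apply/negP => t1_gt.
have t2_gt : 8 * (M' + 1) < t2.+1%:R.
  by rewrite -(ltr_pM2l (_ : 0 < 1 + del)) ?(lt_trans t1_gt) //; lra.
have le21 : (t2.+1 <= t1)%N.
  by apply: t2min => x; apply: le_trans (t1P x) _; lra.
have [s [s_lt s_ge s_par]] : exists s, [/\ (s < t2.+1)%N, (t2 <= s.+1)%N & odd s = odd t1].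
  have [e|ne] := eqVneq (odd t2) (odd t1); first by exists t2.
  case: t2 {t2P t2min t12 le21} t2_gt ne => [|t2] t2_gt ne.
    have : (1 : R) < 1 by apply: le_lt_trans t2_gt; lra.
    by rewrite ltxx.
  exists t2; split => //.
  by move: ne => /=; case: odd; case: odd.
have [x tv_s] : exists x, 1 - eps < total_variation (kernel_pow (@P n) s x) (@pi n).
  apply: contrapT => no; move: s_lt; apply/negP; rewrite -leqNgt; apply: t2min => x.
  by rewrite leNgt; apply/negP => gt; apply: no; exists x.
have [j t1E] : exists j, t1 = (s + j.*2)%N.
  exists (t1 - s)./2; rewrite -[X in (_ + X)%N]add0n.
  have st1 : (s <= t1)%N by apply: leq_trans le21; apply: ltnW.
  have <- : odd (t1 - s) = 0%N :> nat by rewrite oddB // s_par addbb.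
  by rewrite odd_double_half subnKC.
have := harmonic_telescope s j (tvn x); rewrite -t1E.
have := t1P x; set tv1 := total_variation _ _; move: tv_s; set tvs := total_variation _ _.
move=> tvs_gt tv1_le.
have s1 : (t2.+1%:R : R) <= s.+1%:R + 1 by rewrite natr1 ler_nat ltnS.
have t1R : (t1%:R : R) = s.+1%:R - 1 + 2 * j%:R.
  by rewrite t1E -addnn !natrD -natr1; ring.
have jM : (j%:R : R) * M <= j%:R * M' by rewrite ler_wpM2l // ler_norm.
set tau : R := t2.+1%:R in t12 t2_gt s1; set sig : R := s.+1%:R in s1 t1R *.
set J : R := j%:R in t1R jM *.
have sig0 : 0 <= sig by rewrite ler0n.
have : 2^-1 * sig <= (tvs - tv1) * sig by rewrite ler_wpM2r //; lra.
have : J * M' <= (del * tau + 2) / 2 * M' by rewrite ler_wpM2r //; lra.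
have : M' * del * tau <= 4^-1 * tau by rewrite ler_wpM2r //; lra.
nra.
Unshelve. all: by end_near.
Qed.

Theorem theoremA (R : realType) (G : FIgraph)
    (pi : forall n : nat, G n -> R) :
  FIgraph_transitive G ->
  (\forall n \near \oo,
     stationary (simple_random_walk R (@FIedge G n)) (@pi n)) ->
  ~ exhibits_cutoff (fun n : nat => simple_random_walk R (@FIedge G n)) pi.
Proof.
move=> transG _; have [M tvM] := FIgraph_tv_increment R transG.
apply: (no_cutoff (M := M)); apply: filterS tvM => n tvn x t.
exact: tvn.
Qed.
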